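(* Let $(X,\mathsf d,\mathfrak m)$ be a metric measure space with gauge function $\mathsf G$. Let $\beta$ be a distortion coefficient and assume that $\beta_t(+\infty)=+\infty$ for all $t\in(0,1)$ (this is in particular the case if $\mathcal D<+\infty$). - If $(X,\mathsf d,\mathfrak m,\mathsf G)$ satisfies $\mathsf{MCP}(\beta)$, then for all $x\in\mathrm{supp}\,\mathfrak m$ it holds $\mathsf G(x,y)<\mathcal D$ for $\mathfrak m$-a.e. $y\in X$, $y\ne x$. In particular, $\mathrm{diam}_{\mathsf G}(\mathrm{supp}\,\mathfrak m)\le\mathcal D$. - If $(X,\mathsf d,\mathfrak m,\mathsf G)$ satisfies $\mathsf{CD}(\beta,n)$ for some $n\in[1,+\infty)$, then $\mathsf G(x,y)<\mathcal D$ for $\pi$-a.e. $(x,y)\in X\times X$, for all $\pi=(\mathrm e_0,\mathrm e_1)_\sharp\nu$, where $\nu\in\mathrm{OptGeo}(\mu_0,\mu_1)$ is such that the $\mathsf{CD}(\beta,n)$ inequality holds.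
   Context: A metric measure space is a complete separable metric space $(X,\mathsf d)$ with a non-negative Borel measure $\mathfrak m$ finite on bounded sets; a gauge function is a Borel map $\mathsf G:X\times X\to[0,+\infty]$. $\mathrm{Geo}(X)$: curves $\gamma:[0,1]\to X$ with $\mathsf d(\gamma_s,\gamma_t)=|s-t|\mathsf d(\gamma_0,\gamma_1)$; $\mathrm e_t(\gamma)=\gamma_t$. **Distortion coefficient.** Given $\mathsf s:[0,\infty)\to\mathbb R$ continuous with $\mathsf s(\theta)=c\theta^N+o(\theta^N)$ as $\theta\to0$ for some $c>0$, $N\in[1,\infty)$, let $\mathcal D=\inf\{\theta>0:\mathsf s(\theta)=0\}\in(0,+\infty]$. For $t\in[0,1]$, $\theta\in[0,+\infty]$: $\beta_t(0)=t^N$; $\beta_t(\theta)=\mathsf s(t\theta)/\mathsf s(\theta)$ if $0<\theta<\mathcal D$; $\beta_t(\theta)=\liminf_{\phi\to\mathcal D^-}\mathsf s(t\phi)/\mathsf s(\phi)$ if $\theta\ge\mathcal D$. **$\mathsf G$-diameter** of a non-empty set $S$: $\mathrm{diam}_{\mathsf G}(S)=\sup_{x\in S}\big(\mathfrak m\text{-}\mathrm{ess\,sup}_{y\in S,\,y\ne x}\mathsf G(x,y)\big)$. **Optimal transport.** $W_2$ is the quadratic Wasserstein distance; $\mathrm{OptGeo}(\mu_0,\mu_1)$ is the set of $\nu\in\mathcal P(\mathrm{Geo}(X))$ such that $(\mathrm e_0,\mathrm e_1)_\sharp\nu$ is an optimal coupling for the cost $\mathsf d^2$; $\nu$ induces the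 $W_2$-geodesic $\mu_t=(\mathrm e_t)_\sharp\nu$. $\mathrm{Ent}(\mu|\mathfrak m)=\int\rho\log\rho\,d\mathfrak m$ if $\mu=\rho\mathfrak m$ has finite second moment and $\rho\log\rho\in L^1$, $+\infty$ otherwise; $\mathrm U_n(\mu|\mathfrak m)=\exp(-\mathrm{Ent}(\mu|\mathfrak m)/n)$ (equal to $0$ if $\mathrm{Ent}=+\infty$). $\mathcal P_{bs}$: probability measures with bounded support in $\mathrm{supp}\,\mathfrak m$; $\mathcal P_{bs}^*$: those with finite entropy. **$\mathsf{CD}(\beta,n)$**: for all $\mu_0\in\mathcal P_{bs}$, $\mu_1\in\mathcal P_{bs}^*$ with disjoint supports there is a $W_2$-geodesic $(\mu_t)$ induced by $\nu\in\mathrm{OptGeo}(\mu_0,\mu_1)$ such that the following inequality (the $\mathsf{CD}(\beta,n)$ inequality) holds for all $t\in(0,1)$: $$\mathrm U_n(\mu_t|\mathfrak m)\ge e^{\frac1n\int\log\beta_{1-t}(\mathsf G(\gamma_1,\gamma_0))\,\nu(d\gamma)}\mathrm U_n(\mu_0|\mathfrak m)+e^{\frac1n\int\log\beta_t(\mathsf G(\gamma_0,\gamma_1))\,\nu(d\gamma)}\mathrm U_n(\mu_1|\mathfrak m)\qquad(\infty\cdot0=0).$$ In the second bullet, $\mu_0\in\mathcal P_{bs}$ and $\mu_1\in\mathcal P^*_{bs}$ have disjoint supports. **$\mathsf{MCP}(\beta)$**: for every $\bar x\in\mathrm{supp}\,\mathfrak m$ and $\mu_1\in\mathcal P_{bs}^*$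 with $\bar x\notin\mathrm{supp}\,\mu_1$ there is a $W_2$-geodesic from $\delta_{\bar x}$ to $\mu_1$ with $\mathrm U_n(\mu_t|\mathfrak m)\ge\exp\big(\frac1n\int\log\beta_t(\mathsf G(\bar x,x))\,\mu_1(dx)\big)\mathrm U_n(\mu_1|\mathfrak m)$ for all $t\in(0,1)$, for some (equivalently every) $n\ge1$. *)

(* Defs.v *)
From HB Require Import structures.
From mathcomp Require Import all_boot all_order all_algebra.
From mathcomp Require Import interval_inference.
From mathcomp Require Import all_classical all_reals all_analysis.
From mathcomp Require Import measurable_realfun ess_sup_inf.

Set Implicit Arguments.
Unset Strict Implicit.
Unset Printing Implicit Defensive.

Import Order.TTheory GRing.Theory Num.Theory.
Import numFieldNormedType.Exports.

Local Open Scope classical_set_scope.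
Local Open Scope ring_scope.

(* Complete metric spaces; the library's [completeType] is pointed, so the
   space is nonempty. *)
#[short(type="completeMetricType")]
HB.structure Definition CompleteMetric (K : numDomainType) :=
  {T of Complete T & Metric K T}.

Definition separable (T : topologicalType) : Prop :=
  exists2 S : set T, countable S & dense S.

(* The Borel sigma-algebra.  On the product [borel X * borel X] the library
   puts the product sigma-algebra, which is the Borel sigma-algebra of the
   product space when X is separable metric. *)
Notation borel X := (g_sigma_algebraType (@open X)).

Section metric_measure.
Context {R : realType} {X : completeMetricType R}.

Definition mbounded (A : set X) : Prop :=
  exists M : R, forall x y, A x -> A y -> mdist x y <= M.

Definition finite_on_bounded (m : {measure set (borel X) -> \bar R}) : Prop :=
  forall A : set (borel X), measurable A -> mbounded A -> (m A < +oo)%E.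

Definition gauge (G : X -> X -> \bar R) : Prop :=
  (forall x y, 0 <= G x y)%E /\
  measurable_fun setT ((fun p => G p.1 p.2) : borel X * borel X -> \bar R).

Definition supp (m : {measure set (borel X) -> \bar R}) : set X :=
  [set x | forall U : set X, open U -> U x -> (0 < m U)%E].

(* The value -oo off [S `\ x] amounts to taking the essential supremum over
   [S `\ x] only. *)
Definition diamG (m : {measure set (borel X) -> \bar R})
    (G : X -> X -> \bar R) (S : set X) : \bar R :=
  ereal_sup [set ess_sup m (patch (fun=> -oo%E) (S `\ x) (G x)) | x in S].

End metric_measure.

Section distortion.
Context {R : realType}.

Definition distortion_profile (s : R -> R) (N : R) : Prop :=
  [/\ 1 <= N,
      {within `[0, +oo[%classic, continuous s} &
      exists2 c : R, 0 < c &
        (fun theta : R => s theta - c * theta `^ N : R^o)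
          =o_ (0^'+) (fun theta : R => theta `^ N : R^o)].

Definition Dparam (s : R -> R) : \bar R :=
  ereal_inf (EFin @` [set theta | 0 < theta /\ s theta = 0]).

(* [Dparam s] is never -oo. *)
Definition left_of_Dparam (s : R -> R) : set_system R :=
  match Dparam s with
  | r%:E => r^'-
  | +oo%E => pinfty_nbhs R
  | -oo%E => ninfty_nbhs R
  end.

Definition beta (s : R -> R) (N t : R) (theta : \bar R) : \bar R :=
  if theta == 0%E then (t `^ N)%:E
  else if (theta < Dparam s)%E then
    (s (t * fine theta) / s (fine theta))%:E
  else limf_einf (fun phi : R => (s (t * phi) / s phi)%:E) (left_of_Dparam s).

End distortion.

Section geodesics.
Context {R : realType} {X : completeMetricType R}.

Definition geodesic (gamma : {uniform {i01 R} -> X}) : Prop :=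
  forall s t : {i01 R}, mdist (gamma s) (gamma t) =
    `|s%:num - t%:num| * mdist (gamma 0%:i01) (gamma 1%:i01).

Lemma geodesic_cst (x : X) : geodesic (fun=> x).
Proof. by move=> s t; rewrite !mdistxx mulr0. Qed.

End geodesics.

Section geo.
Context {R : realType} (X : completeMetricType R).

Definition geo : Type := set_type (@geodesic R X).

HB.instance Definition _ := Topological.on geo.
HB.instance Definition _ :=
  isPointed.Build geo (SigSub (mem_set (geodesic_cst (point : X)))).

End geo.

Section evaluation.
Context {R : realType} {X : completeMetricType R}.

Definition ev (t : {i01 R}) (gamma : borel (geo X)) : borel X :=
  set_val gamma t.

Definition ev01 (gamma : borel (geo X)) : borel X * borel X :=
  (ev 0%:i01 gamma, ev 1%:i01 gamma).

Lemma continuous_ev (t : {i01 R}) :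
  continuous (fun gamma : geo X => set_val gamma t : X).
Proof.
move=> gamma; apply: (@continuous_comp (geo X) {uniform {i01 R} -> X} X
  set_val (fun f => f t)); first exact: initial_continuous.
move=> W /=; rewrite -nbhs_entourageE => -[E entE EW].
apply/(uniform_nbhs (A:=setT)); exists E; split => // h Eh.
by apply: EW; rewrite /xsection/= inE; exact: Eh.
Qed.

Lemma measurable_ev t : measurable_fun [set: borel (geo X)] (ev t).
Proof.
apply: (@measurability _ _ (borel (geo X)) (borel X) _ _ (@open X)) => //.
move=> _ [U oU <-]; rewrite setTI; apply: sub_sigma_algebra.
apply: (open_comp (f:=fun gamma : geo X => set_val gamma t : X)) => // x _.
exact: continuous_ev.
Qed.

HB.instance Definition _ t :=
  isMeasurableFun.Build _ _ _ _ (ev t) (measurable_ev t).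

Lemma measurable_ev01 : measurable_fun [set: borel (geo X)] ev01.
Proof. exact: measurable_fun_pair (measurable_ev _) (measurable_ev _). Qed.

HB.instance Definition _ :=
  isMeasurableFun.Build _ _ _ _ ev01 measurable_ev01.

End evaluation.

Section transport.
Context {R : realType} {X : completeMetricType R}.
Local Open Scope ereal_scope.
Implicit Types (mu : probability (borel X) R)
  (pi : probability (borel X * borel X)%type R).

(* Measures are total set functions in the library: only their values on
   measurable sets are meaningful. *)
Definition coupling mu0 mu1 pi : Prop :=
  forall A : set (borel X), measurable A ->
    pi (fst @^-1` A) = mu0 A /\ pi (snd @^-1` A) = mu1 A.

Definition cost2 pi : \bar R :=
  \int[pi]_p ((mdist (p.1 : X) (p.2 : X)) ^+ 2)%:E.

Definition optimal_coupling mu0 mu1 pi : Prop :=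
  coupling mu0 mu1 pi /\
  forall pi', coupling mu0 mu1 pi' -> cost2 pi <= cost2 pi'.

Definition W2 mu0 mu1 : \bar R :=
  ereal_inf [set cost2 pi | pi in coupling mu0 mu1] `^ (2^-1)%R.

Definition OptGeo mu0 mu1 (nu : probability (borel (geo X)) R) : Prop :=
  optimal_coupling mu0 mu1 (distribution nu ev01).

Definition finite_second_moment mu : Prop :=
  exists x0 : X, \int[mu]_x ((mdist x0 (x : X)) ^+ 2)%:E < +oo.

Definition W2_geodesic (mu_ : {i01 R} -> probability (borel X) R) : Prop :=
  (forall t, finite_second_moment (mu_ t)) /\
  forall s t, W2 (mu_ s) (mu_ t) =
    `|s%:num - t%:num|%:E * W2 (mu_ (0%:i01)%R) (mu_ (1%:i01)%R).

End transport.

Section entropy.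
Context {R : realType} {X : completeMetricType R}.
Variable m : {measure set (borel X) -> \bar R}.
Local Open Scope ereal_scope.
Implicit Types (mu : probability (borel X) R) (rho : X -> R).

Definition is_density mu rho : Prop :=
  [/\ measurable_fun [set: borel X] rho, (forall x, 0 <= rho x)%R &
      forall A : set (borel X), measurable A ->
        mu A = \int[m]_(x in A) (rho x)%:E].

(* [ln 0 = 0] in the library. *)
Definition rho_log_rho rho (x : borel X) : \bar R := (rho x * ln (rho x))%:E.

Definition Ent_density mu rho : Prop :=
  [/\ is_density mu rho, finite_second_moment mu &
      m.-integrable setT (rho_log_rho rho)].

(* Densities agree m-a.e., so the value does not depend on the chosen one. *)
Definition Ent mu : \bar R :=
  if pselect (exists rho, Ent_density mu rho) is left h
  then \int[m]_x rho_log_rho (projT1 (cid h)) x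
  else +oo.

Definition Un (n : R) mu : \bar R := expeR (- (n^-1%:E * Ent mu)).

Definition Pbs mu : Prop := mbounded (supp mu) /\ supp mu `<=` supp m.

Definition Pbs_star mu : Prop := Pbs mu /\ Ent mu \is a fin_num.

End entropy.

Section curvature_dimension.
Context {R : realType} {X : completeMetricType R}.
Variables (m : {measure set (borel X) -> \bar R}) (G : X -> X -> \bar R).
Variables (s : R -> R) (N : R).
Local Open Scope ereal_scope.
Implicit Types mu : probability (borel X) R.

Definition CD_inequality (n : R) mu0 mu1
    (nu : probability (borel (geo X)) R) : Prop :=
  forall t : {i01 R}, (0 < t%:num < 1)%R ->
    expeR (n^-1%:E * \int[nu]_gamma
        lne (beta s N (1 - t%:num)
          (G (ev (1%:i01)%R gamma) (ev (0%:i01)%R gamma))))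
      * Un m n mu0
    + expeR (n^-1%:E * \int[nu]_gamma
        lne (beta s N t%:num (G (ev (0%:i01)%R gamma) (ev (1%:i01)%R gamma))))
      * Un m n mu1
    <= Un m n (distribution nu (ev t)).

Definition CD (n : R) : Prop :=
  forall mu0 mu1, Pbs m mu0 -> Pbs_star m mu1 -> supp mu0 `&` supp mu1 = set0 ->
    exists2 nu, OptGeo mu0 mu1 nu & CD_inequality n mu0 mu1 nu.

Definition MCP : Prop :=
  exists2 n : R, (1 <= n)%R &
  forall (x : X) mu1, supp m x -> Pbs_star m mu1 -> ~ supp mu1 x ->
  exists mu_ : {i01 R} -> probability (borel X) R,
    [/\ W2_geodesic mu_,
        (forall A : set (borel X), measurable A ->
          mu_ (0%:i01)%R A = \d_(x : borel X) A),
        (forall A : set (borel X), measurable A ->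
          mu_ (1%:i01)%R A = mu1 A) &
        forall t : {i01 R}, (0 < t%:num < 1)%R ->
          expeR (n^-1%:E * \int[mu1]_y lne (beta s N t%:num (G x y)))
            * Un m n mu1
          <= Un m n (mu_ t)].

End curvature_dimension.

(* Main.v *)
(* On the set where [G >= Dparam s] the coefficient [beta_t] equals [+oo], while
   [beta_t] is bounded below by a positive constant: [s (t x) / s x] is close to
   [t `^ N] near 0, is large near [Dparam s], and is continuous and positive in
   between.  So if this set is charged, the integral of [lne beta_t] is [+oo],
   and the right-hand side of the CD or MCP inequality is infinite whereas
   [Un] is always finite.  For MCP this is applied to the normalised restriction
   of [m] to the part of [{G x >= Dparam s}] in an annulus around [x]. *)
Require Import Defs.
From HB Require Import structures.
From mathcomp Require Import all_boot all_order all_algebra.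
From mathcomp Require Import interval_inference ring lra.
From mathcomp Require Import all_classical all_reals all_analysis.
From mathcomp Require Import measurable_realfun ess_sup_inf.
Import Order.TTheory GRing.Theory Num.Theory.
Import numFieldNormedType.Exports.
Local Open Scope classical_set_scope.
Local Open Scope ring_scope.
Local Open Scope ereal_scope.

(** * Distortion profiles and lower bounds for their coefficients *)

Section profile.
Context {R : realType} (s : R -> R) (N : R).
Hypothesis sN : distortion_profile s N.
Local Open Scope ring_scope.

(** The little-o estimate with tolerance half the leading coefficient traps the ratio of [s x] to
    the power between half and three halves of that coefficient. The [c] of the statement is this
    half, whence the factor 3. *)
Lemma distortion_profile_near0 : exists2 c : R, 0 < c &
  exists2 d : R, 0 < d & forall x : R, 0 < x < d ->
    c * x `^ N <= s x <= 3 * c * x `^ N.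
Proof.
case: sN => _ _ [c c0 /eqoP] h.
exists (c / 2); first by rewrite divr_gt0.
have {h} := h (c / 2); rewrite divr_gt0// => /(_ isT).
rewrite /at_right near_withinE => /nbhs_ballP[d /= d0 dh].
exists d => // x /andP[x0 xd].
have /dh : ball (0 : R) d x by rewrite /ball/= sub0r normrN gtr0_norm.
move=> /(_ x0)/=; rewrite (ger0_norm (powR_ge0 _ _)) ler_norml.
set p := x `^ N; lra.
Qed.

Lemma distortion_profile_continuous (x : R) : 0 < x -> {for x, continuous s}.
Proof.
case: sN => _ cs _ x0.
have sub : `]0, +oo[%classic `<=` (`[0, +oo[%classic : set R).
  by move=> y/=; rewrite !in_itv/= !andbT => /ltW.
have := continuous_subspaceW sub cs.
rewrite continuous_open_subspace; last exact: interval_open.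
by apply; rewrite inE/= in_itv/= x0.
Qed.

Lemma Dparam_gt0 : (0 < Dparam s)%E.
Proof.
have [c c0 [d d0 h]] := distortion_profile_near0.
apply: (@lt_le_trans _ _ d%:E); first by rewrite lte_fin.
apply: le_ereal_inf_tmp => _ [x [x0 sx0] <-]; rewrite lee_fin leNgt.
apply/negP => xd; have := h x; rewrite x0 xd sx0 => /(_ isT)/andP[+ _].
by rewrite leNgt mulr_gt0// powR_gt0.
Qed.

(** Since [s] is positive near 0, a nonpositive value at [x] would force, by the intermediate value
    theorem, a zero at or before [x], hence [Dparam s <= x]. *)
Lemma distortion_profile_gt0 (x : R) :
  0 < x -> (x%:E < Dparam s)%E -> 0 < s x.
Proof.
move=> x0 xD; rewrite ltNge; apply/negP => sx.
have [c c0 [d d0 h]] := distortion_profile_near0.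
pose y := Num.min x d / 2.
have md0 : 0 < Num.min x d by rewrite lt_min x0.
have [mx md] : Num.min x d <= x /\ Num.min x d <= d.
  by rewrite !ge_min !lexx orbT.
have [y0 yx yd] : [/\ 0 < y, y < x & y < d] by rewrite /y; split; lra.
have sy : 0 < s y.
  have := h y; rewrite y0 yd => /(_ isT)/andP[+ _].
  by apply: lt_le_trans; rewrite mulr_gt0// powR_gt0.
have [||z] := @IVT _ s y x 0 (ltW yx).
- apply: continuous_in_subspaceT => z; rewrite inE/= in_itv/= => /andP[yz _].
  by apply: distortion_profile_continuous; exact: lt_le_trans yz.
- by rewrite ge_min le_max sx (ltW sy) orbT.
rewrite in_itv/= => /andP[yz zx] sz.
suff : (Dparam s <= z%:E)%E.
  by apply/negP; rewrite -ltNge (le_lt_trans _ xD)// lee_fin.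
by apply: ereal_inf_lbound; exists z => //; split => //; exact: lt_le_trans yz.
Qed.

(** The infimum is attained: if [s r] were nonzero, continuity would keep zeros out of [[r, r + e)]
    and push the infimum up to [r + e]. *)
Lemma distortion_profile_Dparam (r : R) : Dparam s = r%:E -> s r = 0.
Proof.
move=> Dr; have r0 : 0 < r by rewrite -lte_fin -Dr Dparam_gt0.
apply/eqP/negPn/negP => sr.
have := distortion_profile_continuous r r0.
move=> /cvgrPdist_lt/(_ `|s r|); rewrite normr_gt0 => /(_ sr).
move=> /nbhs_ballP[e /= e0 eh].
suff : ((r + e)%:E <= Dparam s)%E by rewrite Dr lee_fin; lra.
apply: le_ereal_inf_tmp => _ [x [x0 sx0] <-]; rewrite lee_fin leNgt.
apply/negP => xe.
have rx : r <= x by rewrite -lee_fin -Dr; apply: ereal_inf_lbound; exists x.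
have /eh : ball r e x.
  by rewrite /ball/= ltr_distlC; apply/andP; split; lra.
by rewrite /= sx0 subr0 ltxx.
Qed.

(** One description of the filter for finite and infinite [Dparam s] alike, which spares the later
    arguments this case distinction. *)
Lemma left_of_DparamP (A : set R) : left_of_Dparam s A <->
  exists2 K : R, (K%:E < Dparam s)%E &
    forall x : R, K < x -> (x%:E < Dparam s)%E -> A x.
Proof.
rewrite /left_of_Dparam; have := Dparam_gt0; case: (Dparam s) => [r| |]//= r0.
- rewrite /at_left; split.
    move=> /nbhs_ballP[e /= e0 eh]; exists (r - e).
      by rewrite lte_fin; lra.
    move=> x; rewrite lte_fin => ex xr; apply: eh => //.
    by rewrite /ball/= ltr_distlC; apply/andP; split; lra.
  move=> [K]; rewrite lte_fin => Kr KA; apply/nbhs_ballP.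
  exists (r - K) => /=; first lra.
  move=> x; rewrite /ball/= ltr_distlC => /andP[Kx _] xr.
  by apply: KA; [lra|rewrite lte_fin].
- split=> [[K [_ KA]]|[K _ KA]]; exists K.
  + by rewrite ltry.
  + by move=> x Kx _; exact: KA.
  + by split; [rewrite num_real|move=> x Kx; apply: KA => //; rewrite ltry].
Qed.

(** The lower limit is minus the upper limit of the opposite function, so the claim is read off an
    infimum of suprema being [-oo]. *)
Lemma limf_einf_eq_pinfty (f : R -> R) :
  limf_einf (EFin \o f) (left_of_Dparam s) = +oo%E <->
  forall M : R, exists2 K : R, (K%:E < Dparam s)%E &
    forall x : R, K < x -> (x%:E < Dparam s)%E -> M <= f x.
Proof.
rewrite /limf_einf /limf_esup; split.
  move=> /eqP; rewrite eqe_oppLR/= => /eqP fN M.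
  have : (ereal_inf [set ereal_sup ((\- (EFin \o f)) @` V) |
      V in left_of_Dparam s] < (- M)%:E)%E by rewrite fN ltNyr.
  move=> /ereal_inf_lt[_ [V /left_of_DparamP[K KD KV]] <- VM].
  exists K => // x Kx xD; rewrite -lerN2 -lee_fin.
  by rewrite (le_trans _ (ltW VM))//; apply: ereal_sup_ubound; exists x;
    [exact: KV|].
move=> h; apply/eqP; rewrite eqe_oppLR/=; apply/eqP/eq_ninfty => M.
have [K KD KM] := h (- M).
apply: (@le_trans _ _ (ereal_sup ((\- (EFin \o f))%E @`
    [set x | K < x /\ (x%:E < Dparam s)%E]))).
  apply: ereal_inf_lbound; exists [set x | K < x /\ (x%:E < Dparam s)%E] => //.
  by apply/left_of_DparamP; exists K.
apply: ge_ereal_sup => _ [x [Kx xD] <-].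
by rewrite -EFinN lee_fin lerNl KM.
Qed.

Lemma beta_ge_Dparam (t : R) (x : \bar R) :
  (Dparam s <= x)%E -> beta s N t x = beta s N t +oo%E.
Proof.
move=> Dx; rewrite /beta gt_eqF ?(lt_le_trans Dparam_gt0 Dx)//.
by rewrite !ltNge Dx leey.
Qed.

Lemma beta_pinftyP (t : R) : beta s N t +oo%E = +oo%E <->
  forall M : R, exists2 K : R, (K%:E < Dparam s)%E &
    forall x : R, K < x -> (x%:E < Dparam s)%E -> M <= s (t * x) / s x.
Proof.
rewrite -(limf_einf_eq_pinfty (fun x => s (t * x) / s x)) /beta gt_eqF//.
by rewrite !ltNge leey.
Qed.

(** As [x] increases to [Dparam s = r], the numerator tends to [s (t * r) > 0] and the denominator
    tends to [s r = 0] through positive values. *)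
Lemma beta_pinfty (t : R) :
  (Dparam s < +oo)%E -> 0 < t < 1 -> beta s N t +oo%E = +oo%E.
Proof.
move=> Dy /andP[t0 t1]; apply/beta_pinftyP => M.
have D0 := Dparam_gt0.
have [r Dr] : exists r : R, Dparam s = r%:E.
  by exists (fine (Dparam s)); rewrite fineK// ge0_fin_numE// ltW.
have r0 : 0 < r by rewrite -lte_fin -Dr.
have tr0 : 0 < t * r by rewrite mulr_gt0.
have str0 : 0 < s (t * r).
  by apply: distortion_profile_gt0 => //; rewrite Dr lte_fin gtr_pMl.
(* A positive bound above [M], so that it can be divided by whatever the sign of [M]. *)
pose M' := `|M| + 1; have M'0 : 0 < M' by rewrite ltr_wpDl.
have num_cvg : s (t * x) @[x --> r] --> s (t * r).
  apply: (@continuous_comp _ _ _ ( *%R t) s).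
    exact: mulrl_continuous.
  exact: distortion_profile_continuous.
have den_cvg : s x @[x --> r] --> 0.
  rewrite -(distortion_profile_Dparam _ Dr).
  exact: distortion_profile_continuous.
have : \forall x \near r, s (t * r) / 2 < s (t * x) /\
    s x < s (t * r) / 2 / M'.
  apply: filterI.
    by apply: (cvgr_gt _ num_cvg); lra.
  by apply: (cvgr_lt _ den_cvg); rewrite !divr_gt0.
move=> /nbhs_ballP[e /= e0 eh].
(* The maximum with 0 keeps [x] positive, as the positivity of [s x] requires. *)
exists (Num.max 0 (r - e)).
  by rewrite Dr lte_fin gt_max r0; lra.
move=> x; rewrite gt_max => /andP[x0 xe] xD.
have sx0 := distortion_profile_gt0 _ x0 xD.
have [] : s (t * r) / 2 < s (t * x) /\ s x < s (t * r) / 2 / M'.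
  apply: eh; rewrite /ball/= ltr_distlC.
  by move: xD; rewrite Dr lte_fin => xr; apply/andP; split; lra.
rewrite ltr_pdivlMr// => h1 h2.
rewrite ler_pdivlMr//.
apply: (@le_trans _ _ (s x * M')).
  by rewrite mulrC ler_pM2l// /M' (le_trans (ler_norm _))// lerDl.
by apply: ltW; exact: lt_trans h1.
Qed.

(** Three ranges: below [d] the power-law bounds apply, above [K] the ratio is at least 1 by
    divergence, and on the compact interval from [d] to [K] a continuous positive function has a
    positive minimum. *)
Lemma beta_ratio_lbound (t : R) : 0 < t < 1 -> beta s N t +oo%E = +oo%E ->
  exists2 c : R, 0 < c & forall x : R, 0 < x -> (x%:E < Dparam s)%E ->
    c <= s (t * x) / s x.
Proof.
move=> /andP[t0 t1] /beta_pinftyP/(_ 1)[K KD Kh].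
have [c c0 [d d0 h]] := distortion_profile_near0.
(* The 3 is the quotient of the upper and lower constants in the bounds near 0. *)
have near0 x : 0 < x < d -> t `^ N / 3 <= s (t * x) / s x.
  move=> /andP[x0 xd].
  have /andP[h1 _] : c * (t * x) `^ N <= s (t * x) <= 3 * c * (t * x) `^ N.
    by apply: h; rewrite mulr_gt0//= (lt_trans _ xd)// gtr_pMl.
  have /andP[h2 h3] : c * x `^ N <= s x <= 3 * c * x `^ N.
    by apply: h; rewrite x0.
  have sx0 : 0 < s x.
    by apply: lt_le_trans h2; rewrite mulr_gt0// powR_gt0.
  rewrite ler_pdivlMr//; apply: le_trans h1.
  rewrite (powRM _ (ltW t0) (ltW x0)).
  apply: (@le_trans _ _ (t `^ N / 3 * (3 * c * x `^ N))).
    by rewrite ler_wpM2l// divr_ge0// powR_ge0.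
  by rewrite le_eqVlt; apply/orP; left; apply/eqP; field.
have t3 : 0 < t `^ N / 3 by rewrite divr_gt0// powR_gt0.
(* When [K < d] the two outer ranges already cover everything. *)
have [dK|Kd] := leP d K; last first.
  exists (Num.min (t `^ N / 3) 1); first by rewrite lt_min t3/=.
  move=> x x0 xD; rewrite ge_min; have [xd|dx] := ltP x d.
    by rewrite near0// x0.
  by rewrite Kh ?orbT// (lt_le_trans Kd).
have K0 : 0 < K by exact: lt_le_trans dK.
have [x|k kdK kmin] := @EVT_min _ (fun x => s (t * x) / s x) _ _ dK.
  apply: continuous_in_subspaceT => {}x; rewrite inE/= in_itv/= => /andP[dx xK].
  have x0 : 0 < x by exact: lt_le_trans dx.
  apply: cvgM.
    apply: (@continuous_comp _ _ _ ( *%R t) s); first exact: mulrl_continuous.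
    by apply: distortion_profile_continuous; rewrite mulr_gt0.
  apply: cvgV; last exact: distortion_profile_continuous.
  rewrite gt_eqF// distortion_profile_gt0// (le_lt_trans _ KD)//.
exists (Num.min (Num.min (t `^ N / 3) 1) (s (t * k) / s k)).
  move: kdK; rewrite in_itv/= => /andP[dk kK].
  have k0 : 0 < k by exact: lt_le_trans dk.
  have kD : (k%:E < Dparam s)%E by rewrite (le_lt_trans _ KD)// lee_fin.
  rewrite !lt_min t3/= ltr01/= divr_gt0// distortion_profile_gt0// ?mulr_gt0//.
  by rewrite (le_lt_trans _ kD)// lee_fin ger_pMl// ltW.
move=> x x0 xD; rewrite !ge_min.
have [xd|dx] := ltP x d; first by rewrite near0// x0.
have [xK|Kx] := leP x K; last by rewrite Kh// orbT.
by rewrite (kmin x) ?orbT// in_itv/= dx.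
Qed.

Lemma beta_lbound (t : R) : 0 < t < 1 -> beta s N t +oo%E = +oo%E ->
  exists2 c : R, 0 < c & forall x : \bar R, (0 <= x)%E ->
    (c%:E <= beta s N t x)%E.
Proof.
move=> t01 ty; have [c c0 h] := beta_ratio_lbound t t01 ty.
move: (t01) => /andP[t0 _].
exists (Num.min c (t `^ N)); first by rewrite lt_min c0 powR_gt0.
move=> x; rewrite le_eqVlt => /predU1P[<-|x0].
  by rewrite /beta eqxx lee_fin ge_min lexx orbT.
have [xD|Dx] := ltP x (Dparam s); last by rewrite beta_ge_Dparam// ty leey.
have xfin : x \is a fin_num by rewrite ge0_fin_numE ?(lt_le_trans xD) ?leey// ltW.
rewrite /beta gt_eqF// xD lee_fin ge_min h ?orTb ?fineK//.
by rewrite fine_gt0// x0 (lt_le_trans xD)// leey.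
Qed.

End profile.

(** * Integrals of possibly non-measurable functions, and normalised restrictions *)

Section integral_without_measurability.
Context d (T : measurableType d) (R : realType).
Variable mu : {measure set T -> \bar R}.
Implicit Types f g : T -> \bar R.

(* [nnintegral] is a supremum over simple functions below the integrand, so it
   is monotone even on non-measurable functions. *)
Lemma ge0_le_integralT f g : (forall x, 0 <= f x) -> (forall x, f x <= g x) ->
  \int[mu]_x f x <= \int[mu]_x g x.
Proof.
move=> f0 fg; rewrite !ge0_integralTE//; last by move=> x; exact: le_trans (fg x).
by apply: le_ereal_sup => _ [h /= hf <-]; exists h => //= x; exact: le_trans (fg x).
Qed.

(** The negative part is at most [|c|] on a space of finite mass, so its integral is finite, while
    the positive part dominates [+oo] times the indicator of [E]. No measurability of [f] is
    assumed, so none has to be proved for [beta]. *)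
Lemma integral_pinfty_on f (c : R) (E : set T) :
  mu setT < +oo -> (forall x, c%:E <= f x) ->
  measurable E -> 0 < mu E -> (forall x, E x -> f x = +oo) ->
  \int[mu]_x f x = +oo.
Proof.
move=> muoo cf mE muE fE.
have fn : \int[mu]_x f^\- x < +oo.
  apply: (@le_lt_trans _ _ (\int[mu]_x (cst `|c|%:E) x)).
    apply: ge0_le_integralT => x; first exact: funeneg_ge0.
    rewrite funenegE ge_max lee_fin normr_ge0 andbT leeNl.
    by rewrite (le_trans _ (cf x))// -EFinN lee_fin lerNl ler_normr lexx orbT.
  by rewrite integral_cst// lte_mul_pinfty.
have fp : \int[mu]_x f^\+ x = +oo.
  apply/eqP; rewrite -leye_eq.
  apply: (@le_trans _ _ (\int[mu]_x ((cst +oo) \_ E) x)).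
    by rewrite -integral_mkcond integral_cst// gt0_mulye.
  apply: ge0_le_integralT => x; first by apply: erestrict_ge0 => y _; rewrite leey.
  rewrite /patch; case: ifPn => [|_]; last exact: funepos_ge0.
  by rewrite inE => /fE fx; rewrite funeposE fx le_max lexx.
by rewrite integralE fp addye// eqe_oppLR/= lt_eqF.
Qed.

(** Domination by the measurable function equal to [|c|] on [B] and [+oo] off [B]; the infinite part
    integrates to 0 because [+oo * 0 = 0]. *)
Lemma ge0_integral_bounded_lty f (c : R) (B : set T) :
  mu setT < +oo -> (forall x, 0 <= f x) -> measurable B -> mu (~` B) = 0 ->
  (forall x, B x -> f x <= c%:E) -> \int[mu]_x f x < +oo.
Proof.
move=> muoo f0 mB muB fc.
have mCB : measurable (~` B) by exact: measurableC.
pose g1 := (cst `|c|%:E) \_ B; pose g2 := (cst +oo : T -> \bar R) \_ (~` B).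
apply: (@le_lt_trans _ _ (\int[mu]_x (g1 x + g2 x))).
  apply: ge0_le_integralT => // x; rewrite /g1 /g2 /patch in_setC.
  case: ifPn => /=; last by rewrite add0e leey.
  by rewrite inE => /fc fxc; rewrite adde0 (le_trans fxc)// lee_fin ler_norm.
rewrite ge0_integralD//; first last.
- exact/(measurable_restrictT _ _).1/measurable_cst.
- by move=> x _; apply: erestrict_ge0 => y _; rewrite leey.
- exact/(measurable_restrictT _ _).1/measurable_cst.
- by move=> x _; apply: erestrict_ge0 => y _ /=; rewrite lee_fin.
rewrite -!integral_mkcond !integral_cst// muB mule0 adde0.
rewrite lte_mul_pinfty ?lee_fin//.
by rewrite (le_lt_trans _ muoo)// le_measure ?inE.
Qed.

Lemma mrestr_probability (B : set T) : measurable B -> 0 < mu B < +oo ->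
  exists P : probability T R, forall A, measurable A ->
    P A = (fine (mu B))^-1%:E * mu (A `&` B).
Proof.
move=> mB /andP[B0 Boo].
have [b Bb] : B !=set0 by apply/set0P/eqP => B_0; rewrite B_0 measure0 ltxx in B0.
(* The Dirac mass is only the fallback of [mnormalize] for zero or infinite mass, excluded here by
   hypothesis. *)
exists (mnormalize (mrestr mu mB) (dirac b)) => A mA.
have mBT : mrestr mu mB [set: T] = mu B by rewrite /mrestr setTI.
rewrite /mnormalize/= /mnormalize/= mBT gt_eqF//= lt_eqF//=.
by rewrite muleC.
Qed.

End integral_without_measurability.

(** * Borel sets, bounded sets and sections of the gauge *)

Section metric_measurability.
Context {R : realType} {X : completeMetricType R}.

Lemma open_mdist_lt (x : X) (r : R) : open [set y | mdist x y < r]%R.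
Proof.
rewrite openE => y /= xyr; apply/nbhs_ballP.
exists (r - mdist x y)%R => /=; first by rewrite subr_gt0.
move=> z; rewrite ballEmdist/= ltrBrDl; apply: le_lt_trans.
exact: metric_triangle.
Qed.

Lemma open_mdist_gt (x : X) (r : R) : open [set y | r < mdist x y]%R.
Proof.
rewrite openE => y /= xyr; apply/nbhs_ballP.
exists (mdist x y - r)%R => /=; first by rewrite subr_gt0.
move=> z; rewrite ballEmdist/= => yz.
have := metric_triangle x z y; rewrite (metric_sym z y); lra.
Qed.

Lemma open_measurable_borel (U : set X) :
  open U -> measurable (U : set (borel X)).
Proof. exact: sub_sigma_algebra. Qed.

Lemma mbounded_ball (x : X) (r : R) (A : set X) :
  (forall y, A y -> mdist x y <= r)%R -> mbounded A.
Proof.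
move=> Ar; exists (r + r)%R => y z Ay Az.
by rewrite (le_trans (metric_triangle y x z))// metric_sym lerD// Ar.
Qed.

Lemma gauge_measurable_section (G : X -> X -> \bar R) (x : X) :
  gauge G -> measurable_fun [set: borel X] (G x : borel X -> \bar R).
Proof.
move=> [_ mG].
exact: (measurable_fun_pair2 (x : borel X) mG).
Qed.

End metric_measurability.

(** * Finiteness and positivity for the entropy and [Un] *)

Section entropy.
Context {R : realType} {X : completeMetricType R}.
Variable m : {measure set (borel X) -> \bar R}.
Implicit Types mu : probability (borel X) R.

(** The density selected by [cid] may differ from [rho], but it too comes with integrability, which
    is all that finiteness requires. *)
Lemma Ent_fin_num mu (rho : X -> R) : Ent_density m mu rho ->
  Ent m mu \is a fin_num.
Proof.
move=> h; rewrite /Ent; case: pselect => [e|[]]; last by exists rho.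
by case: (cid e) => rho' [_ _ irho] /=; exact: (integrable_fin_num measurableT irho).
Qed.

(** Either the entropy is the integral of an integrable function, hence finite, or it is [+oo] by
    convention. This is what keeps [Un] below [+oo]. *)
Lemma Ent_neq_ninfty mu : Ent m mu != -oo.
Proof.
rewrite /Ent; case: pselect => // e.
case: (cid e) => rho' [_ _ irho] /=.
by have /fin_numPlt/andP[h _] := integrable_fin_num measurableT irho; rewrite gt_eqF.
Qed.

Lemma Un_lty (n : R) mu : (0 < n)%R -> Un m n mu < +oo.
Proof.
move=> n0; rewrite /Un ltey expeR_eqy.
have := Ent_neq_ninfty mu; case: (Ent m mu) => [r| |]//= _.
by rewrite gt0_muley// lte_fin invr_gt0.
Qed.

Lemma Un_gt0 (n : R) mu : Ent m mu \is a fin_num -> 0 < Un m n mu.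
Proof. by rewrite /Un; move=> /fineK <-; rewrite expeR_gt0// -EFinM -EFinN ltNyr. Qed.

Lemma Un_ge0 (n : R) mu : 0 <= Un m n mu.
Proof. exact: expeR_ge0. Qed.

Lemma supp_full_measure mu (U : set X) : open U -> mu U = 0 ->
  supp mu `<=` ~` U.
Proof. by move=> oU U0 x + Ux => /(_ U oU Ux); rewrite [X in _ < X]U0 ltxx. Qed.

(** The density is the constant [c] on [B] and 0 elsewhere, so [rho_log_rho] is [c * ln c] times the
    indicator of a set of finite measure. *)
Lemma Ent_normalized_restriction mu (B : set (borel X)) :
  measurable B -> 0 < m B < +oo -> finite_second_moment mu ->
  (forall A, measurable A -> mu A = (fine (m B))^-1%:E * m (A `&` B)) ->
  Ent m mu \is a fin_num.
Proof.
move=> mB /andP[B0 Boo] mu2 muE.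
pose c := ((fine (m B))^-1)%R.
have c0 : (0 <= c)%R by rewrite invr_ge0 fine_ge0.
apply: (@Ent_fin_num _ (fun x => c * \1_B x)%R); split => //.
- split.
  + by apply: measurable_funM => //; exact: measurable_indic.
  + by move=> x; rewrite mulr_ge0// indicE.
  + move=> A mA; under eq_integral do rewrite EFinM.
    rewrite ge0_integralZl_EFin//.
    * by rewrite integral_indic// muE// setIC.
    * by apply/measurable_EFinP; exact: measurable_indic.
- have -> : rho_log_rho (fun x => c * \1_B x)%R =
      (fun x => (c * ln c)%:E * (\1_B x)%:E).
    apply/funext => x; rewrite /rho_log_rho indicE.
    by case: (x \in B); rewrite ?(mulr1, mule1)// !(mulr0, mule0) mul0r.
  apply: integrableZl => //.
  apply/integrableP; split.
    by apply/measurable_EFinP; exact: measurable_indic.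
  under eq_integral do rewrite gee0_abs ?lee_fin ?indicE//.
  under eq_integral do rewrite -indicE.
  by rewrite integral_indic// setIT.
Qed.

End entropy.

(** * Gauge bounds under the curvature-dimension and contraction conditions *)

Section Dparam_bounds.
Context {R : realType} {X : completeMetricType R}.
Variables (m : {measure set (borel X) -> \bar R}) (G : X -> X -> \bar R).
Variables (s : R -> R) (N : R).
Hypotheses (m_fin : finite_on_bounded m) (gG : gauge G).
Hypothesis sN : distortion_profile s N.
Hypothesis beta_oo : forall t : R, (0 < t < 1)%R -> beta s N t +oo = +oo.

Lemma integral_lne_beta_pinfty d (T : measurableType d) (P : probability T R)
    (t : R) (g : T -> \bar R) :
  (0 < t < 1)%R -> (forall x, 0 <= g x) -> measurable_fun setT g ->
  0 < P [set x | Dparam s <= g x] ->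
  \int[P]_x lne (beta s N t (g x)) = +oo.
Proof.
move=> t01 g0 mg PD.
have [c c0 cb] := beta_lbound s N sN t t01 (beta_oo t t01).
have mD : measurable [set x | Dparam s <= g x].
  by rewrite -[X in measurable X]setTI; exact: emeasurable_fun_c_infty.
apply: (@integral_pinfty_on _ _ _ P _ (ln c) _ _ _ mD PD).
- by rewrite [ltLHS](probability_setT P) ltry.
- move=> x; rewrite -lne_EFin//.
  have cx := cb _ (g0 x).
  have c0E : 0 <= c%:E by rewrite lee_fin ltW.
  by rewrite lee_lne// in_itv/= leey andbT// (le_trans c0E).
- by move=> x /= Dx; rewrite (beta_ge_Dparam _ _ sN)// beta_oo.
Qed.

Lemma CD_gauge_lt_Dparam (n : R) (mu0 mu1 : probability (borel X) R)
    (nu : probability (borel (geo X)) R) :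
  (0 < n)%R -> Ent m mu1 \is a fin_num -> CD_inequality m G s N n mu0 mu1 nu ->
  {ae distribution nu ev01,
    forall p : borel X * borel X, G p.1 p.2 < Dparam s}.
Proof.
move=> n0 Ent1 ineq.
have [G0 mG] := gG.
have mE : measurable [set p : borel X * borel X | Dparam s <= G p.1 p.2].
  by rewrite -[X in measurable X]setTI; exact: emeasurable_fun_c_infty.
exists [set p : borel X * borel X | Dparam s <= G p.1 p.2]; split => //.
  apply/eqP; rewrite eq_le measure_ge0 andbT leNgt; apply/negP => nuE.
  have half01 : (0 < (2^-1 : R) < 1)%R by apply/andP; split; lra.
  have h01 : (0 <= (2^-1 : R) <= 1)%R by apply/andP; split; lra.
  (* A single interior time suffices for the contradiction; the midpoint is taken. *)
  pose t : {i01 R} := Itv01 (andP h01).1 (andP h01).2.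
  have := ineq t half01.
  rewrite (@integral_lne_beta_pinfty _ _ nu t%:num
    (fun gamma => G (ev 0%:i01%R gamma) (ev 1%:i01%R gamma)))//; last first.
    exact: (measurableT_comp mG (@measurable_ev01 R X)).
  rewrite gt0_muley ?lte_fin ?invr_gt0//= gt0_mulye ?Un_gt0//.
  (* The other summand is nonnegative, so the sum is not of the form [-oo + +oo]. *)
  rewrite addey; last first.
    by rewrite gt_eqF// (@lt_le_trans _ _ 0)// mule_ge0// ?expeR_ge0// Un_ge0.
  by rewrite leNgt Un_lty.
by move=> p /= /negP; rewrite -leNgt.
Qed.

(** The inner radius keeps [x] outside the support of the target measure; the outer one makes the
    support bounded and the normalising mass finite. *)
Lemma MCP_annulus_negligible (x : X) (k : R) : MCP m G s N -> supp m x -> (0 < k)%R ->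
  m.-negligible [set y : borel X | [/\ Dparam s <= G x y,
    (k^-1 <= mdist x (y : X))%R & (mdist x (y : X) <= k)%R]].
Proof.
move=> [n n1 mcp] mx k0.
have n0 : (0 < n)%R by lra.
set B := [set y | _].
have mGx := gauge_measurable_section G x gG.
have BE : B = [set y : borel X | Dparam s <= G x y] `&`
    ~` [set y | mdist x y < k^-1]%R `&` ~` [set y | k < mdist x y]%R.
  apply/seteqP; split=> y /=.
    by move=> [Dy ky yk]; split; [split => //|]; apply/negP; rewrite -leNgt.
  by move=> [[Dy /negP + /negP]]; rewrite -!leNgt => ky yk; split.
have mB : measurable B.
  rewrite BE; apply: measurableI; first apply: measurableI.
  - by rewrite -[X in measurable X]setTI; exact: emeasurable_fun_c_infty.
  - apply: measurableC; apply: open_measurable_borel; exact: open_mdist_lt.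
  - apply: measurableC; apply: open_measurable_borel; exact: open_mdist_gt.
have Boo : m B < +oo.
  by apply: m_fin => //; apply: (@mbounded_ball _ _ x k) => y [].
apply/(negligibleP m mB)/eqP.
rewrite eq_le measure_ge0 andbT leNgt; apply/negP => B0.
have Bpos : 0 < m B < +oo by rewrite B0 Boo.
have [mu1 mu1E] := mrestr_probability _ _ _ m B mB Bpos.
have mu1_null A : measurable A -> m (A `&` B) = 0 -> mu1 A = 0.
  by move=> mA AB; rewrite mu1E// AB mule0.
have mu1B : mu1 B = 1.
  rewrite mu1E// setIid -[X in _ * X]fineK ?ge0_fin_numE//.
  by rewrite -EFinM mulVf// gt_eqF// fine_gt0.
have mu1CB : mu1 (~` B) = 0.
  by apply: mu1_null; [exact: measurableC|rewrite setICl measure0].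
have supp_le y : supp mu1 y -> (mdist x y <= k)%R.
  move=> /(supp_full_measure _ _ (open_mdist_gt x k)) yk.
  rewrite leNgt; apply/negP/yk.
  apply: mu1_null; first exact: (open_measurable_borel _ (open_mdist_gt x k)).
  rewrite (_ : _ `&` _ = set0) ?measure0//; apply/seteqP; split => // z [/= kz].
  by move=> [_ _]; rewrite leNgt kz.
have supp_x : ~ supp mu1 x.
  move=> /(supp_full_measure _ _ (open_mdist_lt x k^-1)); apply.
    apply: mu1_null; first exact: (open_measurable_borel _ (open_mdist_lt x k^-1)).
    rewrite (_ : _ `&` _ = set0) ?measure0//; apply/seteqP; split => // z [/= kz].
    by move=> [_ + _]; rewrite leNgt kz.
  by rewrite /= mdistxx invr_gt0.
(* An [m]-null open neighbourhood would also be [mu1]-null. *)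
have supp_m : supp mu1 `<=` supp m.
  move=> y y1 U oU Uy; rewrite lt_neqAle measure_ge0 andbT eq_sym.
  apply/negP => /eqP mU0.
  have mU := open_measurable_borel _ oU.
  have := y1 U oU Uy; rewrite [ltRHS]mu1_null ?ltxx//.
  by apply: (@subset_measure0 _ _ _ m _ U) => //; exact: measurableI.
have mu1_2 : finite_second_moment mu1.
  exists x; apply: (@ge0_integral_bounded_lty _ _ _ mu1 _ (k ^+ 2)%R B) => //.
  - by rewrite [ltLHS](probability_setT mu1) ltry.
  - by move=> y; rewrite lee_fin sqr_ge0.
  - move=> y [_ _ yk]; rewrite lee_fin ler_pXn2r// ?nnegrE ?mdist_ge0//.
    exact: ltW.
have mu1_bs : Pbs_star m mu1.
  split; first by split => //; exact: mbounded_ball _ _ _ supp_le.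
  exact: (Ent_normalized_restriction _ _ _ mB Bpos mu1_2 mu1E).
have [mu_ [_ _ _ mcpt]] := mcp x mu1 mx mu1_bs supp_x.
have half01 : (0 < (2^-1 : R) < 1)%R by apply/andP; split; lra.
have h01 : (0 <= (2^-1 : R) <= 1)%R by apply/andP; split; lra.
pose t : {i01 R} := Itv01 (andP h01).1 (andP h01).2.
have := mcpt t half01.
rewrite (@integral_lne_beta_pinfty _ _ mu1 t%:num (G x))//; first last.
- have mD : measurable [set y : borel X | Dparam s <= G x y].
    by rewrite -[X in measurable X]setTI; exact: emeasurable_fun_c_infty.
  apply: (@lt_le_trans _ _ (mu1 B)); first by rewrite mu1B lte01.
  by apply: le_measure; rewrite ?inE// => y [].
- by move=> y; have [] := gG.
rewrite gt0_muley ?lte_fin ?invr_gt0//= gt0_mulye ?Un_gt0//; last first.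
  by have [] := mu1_bs.
by rewrite leNgt Un_lty.
Qed.

(** The annuli of inner radius [1/(k+1)] and outer radius [k+1] exhaust the complement of [x], and a
    countable union of negligible sets is negligible. *)
Lemma MCP_gauge_lt_Dparam (x : X) : MCP m G s N -> supp m x ->
  {ae m, forall y : borel X, y <> x -> G x y < Dparam s}.
Proof.
move=> mcp mx; pose F (k : nat) := [set y : borel X |
  [/\ Dparam s <= G x y, ((k.+1%:R : R)^-1 <= mdist x (y : X))%R
    & (mdist x (y : X) <= k.+1%:R)%R]].
apply: (@negligibleS _ _ _ m (\bigcup_k F k)); last first.
  by apply: negligible_bigcup => k; exact: MCP_annulus_negligible.
move=> y /= /not_implyP[yx /negP]; rewrite -leNgt => Dy.
have xy0 : (0 < mdist x y)%R by rewrite mdist_gt0 eq_sym; exact/eqP.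
(* Any integer above both the distance and its inverse gives an annulus containing [y]; the
   successor in [F] matches [r < (truncn r).+1]. *)
pose r := Num.max (mdist x y) (mdist x y)^-1%R.
have [r1 r2] : (mdist x y <= r)%R /\ ((mdist x y)^-1 <= r)%R.
  by rewrite !le_max !lexx orbT.
have rk := ltW (truncnS_gt r).
exists (Num.truncn r) => //; split => //; last exact: le_trans rk.
by rewrite invf_ple ?posrE//; exact: le_trans rk.
Qed.

Lemma MCP_diamG_le : MCP m G s N -> diamG m G (supp m) <= Dparam s.
Proof.
move=> mcp; apply: ge_ereal_sup => _ [x mx <-]; apply/ess_supP.
apply: filterS (MCP_gauge_lt_Dparam _ mcp mx) => y yD.
(* At [x] itself and off the support the patched value is [-oo], so the bound is trivial there. *)
rewrite /patch; case: ifPn => [|_]; last by rewrite leNye.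
by rewrite inE => -[_ yx]; exact/ltW/yD.
Qed.

End Dparam_bounds.

Theorem proposition4p10 (R : realType) (X : completeMetricType R)
    (m : {measure set (borel X) -> \bar R}) (G : X -> X -> \bar R)
    (s : R -> R) (N : R) :
  separable X -> finite_on_bounded m -> gauge G -> distortion_profile s N ->
  (Dparam s < +oo ->
    forall t : R, (0 < t < 1)%R -> beta s N t +oo = +oo) /\
  ((forall t : R, (0 < t < 1)%R -> beta s N t +oo = +oo) ->
    (MCP m G s N ->
      (forall x : X, supp m x ->
        {ae m, forall y : borel X, y <> x -> G x y < Dparam s}) /\
      diamG m G (supp m) <= Dparam s) /\
    (forall n : R, (1 <= n)%R -> CD m G s N n ->
      forall (mu0 mu1 : probability (borel X) R)
             (nu : probability (borel (geo X)) R),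
        Pbs m mu0 -> Pbs_star m mu1 -> supp mu0 `&` supp mu1 = set0 ->
        OptGeo mu0 mu1 nu -> CD_inequality m G s N n mu0 mu1 nu ->
        {ae distribution nu ev01,
          forall p : borel X * borel X, G p.1 p.2 < Dparam s})).
Proof.
move=> _ m_fin gG sN; split; first by move=> Dy t; exact: (beta_pinfty _ _ sN _ Dy).
move=> beta_oo; split.
  move=> mcp; split; last exact: (MCP_diamG_le _ _ s N).
  by move=> x; exact: (MCP_gauge_lt_Dparam _ _ s N).
move=> n n1 _ mu0 mu1 nu _ [_ Ent1] _ _; apply: (CD_gauge_lt_Dparam m _ s N _ _ _ n mu0 mu1) => //.
by rewrite (lt_le_trans _ n1).
Qed.
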